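(* Let $c>0$ and $a\in(0,1)$, let $(m_n)_{n\ge 2}$ be a sequence of positive integers, write $m=m_n$ and $p=p_n:=n^{-2}$, and for each $n$ let $X=(X_{ij})_{1\le i,j\le n}$ be a random matrix with joint multinomial distribution $\mathcal{M}(m,n^2)$. Assume that $$mp=c\,n^{-a}\,(1+o(1))\quad\text{as } n\to\infty,$$ and that $a\notin\{\frac1k : k\in\mathbb{N}\}$, where $\mathbb{N}=\{1,2,\dots\}$. Then there exists a unique positive integer $k$ such that $$\frac{1}{k+1}<a<\frac1k,$$ and, for this $k$, as $n\to\infty$, $$\mathbb{E}\max_{\sigma\in\mathcal{S}_n}\sum_{i=1}^n X_{i\sigma(i)}=k\,n\,(1+o(1)).$$
   Context: $\mathcal{S}_n$ denotes the group of permutations of $\{1,\dots,n\}$. $\mathcal{M}(m,N)$ denotes the multinomial law with $m$ trials and $N$ equiprobable cells: it is the law of the vector of cell counts when $m$ particles are thrown independently and uniformly into $N$ cells. Under $\mathcal{M}(m,n^2)$ the cells are the $n^2$ positions $(i,j)$ of the matrix, so each $X_{ij}$ has the binomial distribution with $m$ trials and success probability $p=n^{-2}$, and $\sum_{i,j}X_{ij}=m$. *)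

(* Defs.v *)
From HB Require Import structures.
From mathcomp Require Import all_boot all_order all_algebra all_fingroup.
From mathcomp Require Import all_classical all_reals all_analysis.
Set Implicit Arguments.
Unset Strict Implicit.
Unset Printing Implicit Defensive.
Import Order.TTheory GRing.Theory Num.Theory.
Import numFieldNormedType.Exports.
Local Open Scope classical_set_scope.
Local Open Scope ring_scope.

Definition cell_count (C : finType) (m : nat) (f : {ffun 'I_m -> C}) (x : C)
  : nat := #|[set l : 'I_m | f l == x]%SET|.

(* The point masses of the law of the vector of cell counts when m particles
   are thrown independently and uniformly into the cells of C, i.e. when the
   throw f is uniform on all functions 'I_m -> C (#|C| ^ m of them). If there
   is no cell and m > 0, this is identically 0 and not a probability. *)
Definition multinomial_pmf (R : realType) (C : finType) (m : nat)
    (v : C -> nat) : R :=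
  #|[set f : {ffun 'I_m -> C} | [forall x, cell_count f x == v x]]%SET|%:R
  / (#|C| ^ m)%:R.

(* The law of the family X is a law on the countable set of families of
   natural numbers indexed by C, so it is determined by its point masses. *)
Definition multinomial_law d (T : measurableType d) (R : realType)
    (P : probability T R) (C : finType) (m : nat)
    (X : C -> {RV P >-> nat}) : Prop :=
  forall v : C -> nat,
    P [set t | forall x : C, X x t = v x] = (multinomial_pmf R m v)%:E.

(* Main.v *)
Require Import Defs.
From HB Require Import structures.
From mathcomp Require Import all_boot all_order all_algebra all_fingroup.
From mathcomp Require Import all_classical all_reals all_analysis.
From mathcomp Require Import measurable_realfun ring lra.
Set Implicit Arguments.
Unset Strict Implicit.
Unset Printing Implicit Defensive.
Import Order.TTheory GRing.Theory Num.Theory.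
Import numFieldNormedType.Exports.
Local Open Scope ring_scope.

(** Put n = the side of the matrix, mu = m / n^2, so that mu is close to
c n^(-a) and 1/(k+1) < a < 1/k. A cell is rarely hit more than k times, and
cells hit k times are plentiful enough to form an almost perfect matching of
rows and columns; these two facts give the upper and the lower bound.

Reduction to counting. The expectation depends only on the law of the cell
counts, hence equals the uniform average, over all throws of m balls into the
n^2 cells, of the best assignment for the counts ([expectation_multinomial]).
Everything probabilistic then takes place on finite sets of functions.

Upper bound ([mean_max_assignment_le]). Truncating every entry at k costs at
most the sum over all cells of the excess of the count x over k, and that excess
is at most the binomial x choose k+1, whose average is at most mu^(k+1). The
total cost is at most n^2 mu^(k+1), of order n n^(1 - a(k+1)), which is o(n)
because a > 1/(k+1).

Lower bound ([mean_max_assignment_ge]). Treat the rows one after the other; row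
i takes a free column in which its cell holds at least k balls, if there is one
([greedy]). A row that finds none takes an arbitrary free column, so that exactly
n - i columns are free at row i whatever happened before. Once the row of each
ball is fixed, the columns of the balls in row i are independent of what the
earlier rows saw. It remains to show that r independent balls, r close to m/n,
put k of them into a common box of a given set S of boxes, unless S is small.
Split the balls into k groups of size b: by Chebyshev the first group hits at
least |S| q / 2 boxes of S, where q is the probability that a given box is hit;
the second group hits a fraction q/2 of those, and so on
([mean_no_full_box]). The probability of failure is at most
4k / (|S| (q/2)^k). As q is of order mu, and n mu^k has order n^(1 - ak) and
tends to infinity because a < 1/k, the failures are negligible for all rows but
the last eps n ones. *)

(** * Uniform averages over finite types *)

Section Mean.
Variable R : realFieldType.

Definition mean (T : finType) (F : T -> R) : R := (\sum_t F t) / #|T|%:R.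

Lemma eq_mean (T : finType) (F G : T -> R) : F =1 G -> mean F = mean G.
Proof. by move=> FG; rewrite /mean (eq_bigr G). Qed.

Lemma ler_mean (T : finType) (F G : T -> R) :
  (forall t, F t <= G t) -> mean F <= mean G.
Proof. by move=> FG; rewrite ler_wpM2r ?invr_ge0 ?ler0n// ler_sum. Qed.

Lemma meanD (T : finType) (F G : T -> R) :
  mean (fun t => F t + G t) = mean F + mean G.
Proof. by rewrite /mean big_split mulrDl. Qed.

Lemma meanZ (T : finType) (c : R) (F : T -> R) :
  mean (fun t => c * F t) = c * mean F.
Proof. by rewrite /mean -mulr_sumr mulrA. Qed.

Lemma meanB (T : finType) (F G : T -> R) :
  mean (fun t => F t - G t) = mean F - mean G.
Proof. by rewrite /mean sumrB mulrBl. Qed.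

Lemma mean_sum (T I : finType) (P : pred I) (F : I -> T -> R) :
  mean (fun t => \sum_(i | P i) F i t) = \sum_(i | P i) mean (F i).
Proof. by rewrite /mean exchange_big mulr_suml. Qed.

Lemma mean_cst (T : finType) (c : R) :
  (0 < #|T|)%N -> mean (fun _ : T => c) = c.
Proof.
move=> T_gt0; rewrite /mean sumr_const -(mulr_natr c) mulfK//.
by rewrite pnatr_eq0 -lt0n.
Qed.

Lemma mean_ge0 (T : finType) (F : T -> R) : (forall t, 0 <= F t) -> 0 <= mean F.
Proof. by move=> F0; rewrite divr_ge0 ?sumr_ge0. Qed.

Lemma mean_indic_le1 (T : finType) (p : pred T) :
  mean (fun t => (p t)%:R) <= 1.
Proof.
have [T0|T_gt0] := posnP #|T|.
  by rewrite /mean T0 invr0 mulr0 ler01.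
rewrite -[leRHS](mean_cst 1 T_gt0); apply: ler_mean => t.
by rewrite lern1 leq_b1.
Qed.

(** Chebyshev's inequality at half the mean; v is any bound on the variance. *)
Lemma mean_chebyshev (T : finType) (W : T -> R) (mu v : R) :
  (0 < #|T|)%N -> 0 < mu -> mean W = mu ->
  mean (fun t => W t ^+ 2) <= mu ^+ 2 + v ->
  mean (fun t => (W t <= mu / 2)%R%:R) <= 4 * v / mu ^+ 2.
Proof.
move=> T_gt0 mu_gt0 meanW meanW2.
have -> : 4 * v / mu ^+ 2 = (4 / mu ^+ 2) * v by field; rewrite gt_eqF.
have var_le : mean (fun t => (W t - mu) ^+ 2) <= v.
  have -> : mean (fun t => (W t - mu) ^+ 2)
      = mean (fun t => W t ^+ 2 - (2 * mu * W t - mu ^+ 2)).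
    by apply: eq_mean => t; ring.
  by rewrite !meanB meanZ mean_cst// meanW; lra.
apply: le_trans (ler_wpM2l _ var_le); last by rewrite divr_ge0// sqr_ge0.
rewrite -meanZ; apply: ler_mean => t.
case: (boolP (W t <= mu / 2)%R) => [le_W|_] /=; last first.
  by rewrite mulr_ge0 ?divr_ge0 ?sqr_ge0.
have mu2_gt0 : 0 < mu ^+ 2 by rewrite exprn_gt0.
rewrite mulrAC ler_pdivlMr// mul1r; nra.
Qed.

(** Independence of the values of a uniform random function: distributivity of
the product over the sum. *)
Lemma mean_ffun_prod (I J : finType) (F : I -> J -> R) :
  mean (fun h : {ffun I -> J} => \prod_i F i (h i)) = \prod_i mean (F i).
Proof.
rewrite /mean prodf_div -bigA_distr_bigA/= card_ffun natrX.
by rewrite prodr_const.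
Qed.

Lemma mean_ffun_prod_in (I J : finType) (D : {set I}) (F : I -> J -> R) :
  (0 < #|J|)%N ->
  mean (fun h : {ffun I -> J} => \prod_(i in D) F i (h i))
  = \prod_(i in D) mean (F i).
Proof.
move=> J_gt0.
have -> : mean (fun h : {ffun I -> J} => \prod_(i in D) F i (h i)) =
    mean (fun h : {ffun I -> J} => \prod_i (if i \in D then F i (h i) else 1)).
  by apply: eq_mean => h; rewrite big_mkcond.
rewrite (mean_ffun_prod (fun i j => if i \in D then F i j else 1)).
rewrite [RHS]big_mkcond; apply: eq_bigr => i _.
by case: (i \in D) => //; rewrite mean_cst.
Qed.

(** The function g with its values on D resampled from h. *)
Definition paste (I J : finType) (D : {set I}) (g h : {ffun I -> J}) :
  {ffun I -> J} := [ffun i => if i \in D then h i else g i].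

(** Resampling the values on D with an independent copy preserves the uniform
law: exchanging the values of g and h on D is an involution on pairs. This is
the substitute for conditioning used throughout: after resampling, g is frozen
and only the values on D are random. *)
Lemma mean_paste (I J : finType) (D : {set I}) (F : {ffun I -> J} -> R) :
  mean F = mean (fun g => mean (fun h => F (paste D g h))).
Proof.
set N : R := #|{ffun I -> J}|%:R.
have [N0|N_neq0] := eqVneq N 0; first by rewrite /mean -/N N0 invr0 !mulr0.
have swapK : involutive (fun u : {ffun I -> J} * {ffun I -> J} =>
    (paste D u.1 u.2, paste D u.2 u.1)).
  by move=> [g h]; congr pair; apply/ffunP => i;
    rewrite /= !ffunE; case: (i \in D).
rewrite /mean -/N -mulr_suml.
rewrite pair_bigA /= (reindex_inj (inv_inj swapK)) /=.
have -> : \sum_(u : {ffun I -> J} * {ffun I -> J})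
    F (paste D (paste D u.1 u.2) (paste D u.2 u.1))
    = \sum_(u : {ffun I -> J} * {ffun I -> J}) F u.1.
  apply: eq_bigr => -[g h] _; congr F.
  by apply/ffunP => i; rewrite /= !ffunE; case: (i \in D).
have -> : \sum_(u : {ffun I -> J} * {ffun I -> J}) F u.1 = (\sum_g F g) * N.
  rewrite -(pair_bigA _ (fun g _ => F g)) mulr_suml.
  by apply: eq_bigr => g _; rewrite sumr_const -(mulr_natr (F g)).
by rewrite mulfK.
Qed.

(** A uniform cell is a uniform row together with an independent uniform
column. *)
Lemma mean_ffun_pair (I J K : finType) (F : {ffun I -> J * K} -> R) :
  mean F = mean (fun r : {ffun I -> J} => mean (fun g : {ffun I -> K} =>
    F [ffun i => (r i, g i)])).
Proof.
rewrite /mean -mulr_suml -mulrA -invfM pair_bigA /=.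
congr (_ / _); last first.
  by rewrite !card_ffun card_prod expnMn natrM mulrC.
pose zipf (u : {ffun I -> J} * {ffun I -> K}) : {ffun I -> J * K} :=
  [ffun i => (u.1 i, u.2 i)].
pose unzipf (f : {ffun I -> J * K}) : {ffun I -> J} * {ffun I -> K} :=
  ([ffun i => (f i).1], [ffun i => (f i).2]).
rewrite (reindex zipf)//; exists unzipf => [[r g] _|f _].
  by congr pair; apply/ffunP => i; rewrite !ffunE.
by apply/ffunP => i; rewrite !ffunE; case: (f i).
Qed.

Lemma mean_pred1 (J : finType) (j : J) :
  mean (fun c => (c == j)%:R) = #|J|%:R^-1.
Proof.
by rewrite /mean (bigD1 j)//= eqxx big1 ?addr0 ?mul1r// => c /negPf->.
Qed.

Lemma mean_predC1 (J : finType) (j : J) :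
  mean (fun c => (c != j)%:R) = 1 - #|J|%:R^-1.
Proof.
have J_gt0 : (0 < #|J|)%N by apply/card_gt0P; exists j.
have -> : mean (fun c => (c != j)%:R) = mean (fun c => 1 - (c == j)%:R :> R).
  by apply: eq_mean => c; case: (c == j); rewrite /= ?subr0 ?subrr.
by rewrite meanB mean_cst// mean_pred1.
Qed.

Lemma mean_predC2 (J : finType) (i j : J) : i != j ->
  mean (fun c => (c != i)%:R * (c != j)%:R) = 1 - 2 / #|J|%:R.
Proof.
move=> i_neq_j.
have J_gt0 : (0 < #|J|)%N by apply/card_gt0P; exists j.
have -> : mean (fun c => (c != i)%:R * (c != j)%:R)
    = mean (fun c => 1 - (c == i)%:R - (c == j)%:R :> R).
  apply: eq_mean => c; case: (eqVneq c i) => [->|_].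
    by rewrite (negPf i_neq_j) /= mul0r subr0 subrr.
  by case: (c == j); rewrite /= ?mul1r ?subr0 ?subrr.
by rewrite !meanB mean_cst// !mean_pred1; ring.
Qed.

End Mean.

(** * Boxes holding many balls *)

Section Occupancy.
Variables (R : realFieldType) (I J : finType).
Implicit Types (D : {set I}) (S : {set J}) (h : {ffun I -> J}).

Definition occupancy D h (j : J) : nat := #|[set l in D | h l == j]|.

(** Probability that one given box receives at least one of r balls. *)
Definition hit_prob (r : nat) : R := 1 - (1 - #|J|%:R^-1) ^+ r.

Definition hit D S h : {set J} := [set j in S | (0 < occupancy D h j)%N].

Lemma occupancy_gt0 D h j :
  (0 < occupancy D h j)%N%:R = 1 - \prod_(l in D) (h l != j)%:R :> R.
Proof.
rewrite /occupancy; case: (posnP #|_|) => [/eqP|/card_gt0P[l]].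
  rewrite cards_eq0 => /eqP D0; rewrite big1 ?subrr// => l lD.
  case: eqP => // hlj.
  by have := finset.in_set0 l; rewrite -D0 inE lD hlj eqxx.
rewrite inE => /andP[lD /eqP hlj]; rewrite (bigD1 l)//= hlj eqxx mul0r.
by rewrite subr0.
Qed.

Lemma mean_hit D j : (0 < #|J|)%N ->
  mean (fun h => (0 < occupancy D h j)%N%:R) = hit_prob #|D|.
Proof.
move=> J_gt0; rewrite (eq_mean (fun h => occupancy_gt0 D h j)).
rewrite meanB mean_cst ?card_ffun ?expn_gt0 ?J_gt0//.
rewrite (mean_ffun_prod_in _ (fun _ c => (c != j)%:R))//.
by rewrite prodr_const mean_predC1.
Qed.

(** Two distinct boxes being hit are negatively correlated: both are missed with
probability (1 - 2/N)^r, at most the square of (1 - 1/N)^r. *)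
Lemma mean_hit2 D i j : i != j ->
  mean (fun h => (0 < occupancy D h i)%N%:R * (0 < occupancy D h j)%N%:R)
  <= hit_prob #|D| ^+ 2.
Proof.
move=> i_neq_j.
have J_gt0 : (0 < #|J|)%N by apply/card_gt0P; exists j.
pose z := 1 - 2 / #|J|%:R : R.
have -> : mean (fun h =>
      (0 < occupancy D h i)%N%:R * (0 < occupancy D h j)%N%:R)
   = mean (fun h => (0 < occupancy D h i)%N%:R + ((0 < occupancy D h j)%N%:R
       - (1 - \prod_(l in D) ((h l != i)%:R * (h l != j)%:R)))) :> R.
  by apply: eq_mean => h; rewrite !occupancy_gt0 big_split/=; ring.
rewrite meanD !meanB mean_cst ?card_ffun ?expn_gt0 ?J_gt0// !mean_hit//.
rewrite (mean_ffun_prod_in _ (fun _ c => (c != i)%:R * (c != j)%:R))//.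
rewrite prodr_const mean_predC2// /hit_prob.
have J_ge2 : (2 <= #|J|)%N.
  by have := max_card [set i; j]; rewrite cards2 i_neq_j.
have z_ge0 : 0 <= z.
  rewrite /z subr_ge0 ler_pdivrMr ?ltr0n// mul1r ler_nat//.
have z_le : z <= (1 - #|J|%:R^-1) ^+ 2.
  by rewrite /z; have := sqr_ge0 (#|J|%:R^-1 : R); nra.
have : z ^+ #|D| <= ((1 - #|J|%:R^-1) ^+ #|D|) ^+ 2.
  by rewrite -exprM mulnC exprM lerXn2r ?nnegrE// (le_trans z_ge0).
by rewrite -/z; nra.
Qed.

Lemma hit_prob_le1 r : hit_prob r <= 1.
Proof.
rewrite gerBl; have [J0|J_gt0] := posnP #|J|.
  by rewrite J0 invr0 subr0 expr1n.
by rewrite exprn_ge0// subr_ge0 invf_le1 ?ltr0n// ler1n.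
Qed.

(** By negative correlation the variance of the number of boxes hit is at most
its mean, so Chebyshev's inequality applies. *)
Lemma hit_concentration D S : 0 < hit_prob #|D| -> (0 < #|S|)%N ->
  mean (fun h => (#|hit D S h|%:R <= #|S|%:R * hit_prob #|D| / 2 :> R)%R%:R)
  <= 4 / (#|S|%:R * hit_prob #|D|).
Proof.
set q := hit_prob _ => q_gt0 S_gt0.
have J_gt0 : (0 < #|J|)%N := leq_trans S_gt0 (max_card _).
have hitE h : #|hit D S h|%:R = \sum_(j in S) (0 < occupancy D h j)%N%:R :> R.
  rewrite -sum1_card natr_sum.
  rewrite [RHS](big_setID [set j | (0 < occupancy D h j)%N])/=.
  rewrite [X in _ = _ + X]big1 ?addr0; last first.
    by move=> j; rewrite !inE => /andP[/negPf->].
  rewrite (_ : S :&: _ = hit D S h); last by apply/setP => j; rewrite !inE.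
  by apply: eq_bigr => j; rewrite !inE => /andP[_ ->].
set s : R := #|S|%:R.
have s_gt0 : 0 < s by rewrite ltr0n.
have sq_gt0 : 0 < s * q by rewrite mulr_gt0.
have -> : 4 / (s * q) = 4 * (s * q) / (s * q) ^+ 2.
  by field; rewrite !gt_eqF.
apply: mean_chebyshev => //; first by rewrite card_ffun expn_gt0 J_gt0.
  rewrite (eq_mean hitE) mean_sum.
  under eq_bigr do rewrite mean_hit//.
  by rewrite sumr_const -(mulr_natl q).
have -> : mean (fun h => #|hit D S h|%:R ^+ 2) = \sum_(i in S) \sum_(j in S)
   mean (fun h => (0 < occupancy D h i)%N%:R * (0 < occupancy D h j)%N%:R) :> R.
  rewrite -(eq_bigr _ (fun i _ => mean_sum _ _)) -mean_sum.
  apply: eq_mean => h; rewrite hitE expr2 mulr_suml; apply: eq_bigr => i _.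
  by rewrite mulr_sumr.
have -> : (s * q) ^+ 2 + s * q = \sum_(i in S) (\sum_(j in S) q ^+ 2 + q).
  by rewrite !sumr_const -!(mulr_natl (_ + _)) -!(mulr_natl (_ ^+ _)); ring.
apply: ler_sum => i iS; rewrite (bigD1 i)//= [X in _ <= X + _](bigD1 i)//=.
rewrite [leRHS]addrAC; apply: lerD; last first.
  by apply: ler_sum => j /andP[_ ij]; rewrite mean_hit2 1?eq_sym.
rewrite -[leLHS]add0r; apply: lerD (sqr_ge0 _) _.
rewrite /q -(mean_hit D i J_gt0) le_eqVlt; apply/orP; left; apply/eqP.
by apply: eq_mean => h; case: ltnP; rewrite ?mul0r ?mul1r.
Qed.

(** Induction on k: a group of r balls hits at least |S| q / 2 boxes of S, except
with probability 4 / (|S| q), and the remaining balls, which are independent of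
that group, must bring k - 1 further balls into one of the boxes hit. *)
Lemma mean_no_full_box (k r : nat) D S :
  0 < hit_prob r -> (k * r <= #|D|)%N -> (0 < #|S|)%N ->
  mean (fun h => [forall j in S, (occupancy D h j < k)%N]%:R)
  <= (4 * k)%:R / (#|S|%:R * (hit_prob r / 2) ^+ k) :> R.
Proof.
set q := hit_prob r => q_gt0.
elim: k D S => [|k IHk] D S leD S_gt0.
  have [j jS] := card_gt0P S_gt0.
  rewrite muln0 mul0r -(mul0r #|{ffun I -> J}|%:R^-1) ler_wpM2r ?invr_ge0//.
  rewrite big1// => h _.
  suff /negPf-> : ~~ [forall j in S, (occupancy D h j < 0)%N] by [].
  by apply/forall_inPn; exists j.
have [D1 D1D cardD1] : exists2 D1 : {set I}, D1 \subset D & #|D1| = r.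
  have : (r <= #|D|)%N by apply: leq_trans leD; rewrite leq_pmull.
  case/card_geqP => s [s_uniq s_size sD]; exists [set x in s].
    by apply/fintype.subsetP => x; rewrite inE; apply: sD.
  by rewrite cardsE (card_uniqP s_uniq).
have cardD2 : (k * r <= #|D :\: D1|)%N.
  by rewrite cardsDS// cardD1 leq_subRL ?(leq_trans _ leD) ?leq_pmull// -mulSn.
have J_gt0 : (0 < #|J|)%N := leq_trans S_gt0 (max_card _).
have H_gt0 : (0 < #|{ffun I -> J}|)%N by rewrite card_ffun expn_gt0 J_gt0.
set s : R := #|S|%:R.
have s_gt0 : 0 < s by rewrite ltr0n.
have sq_gt0 : 0 < s * q by rewrite mulr_gt0.
have q2_gt0 : 0 < q / 2 by rewrite divr_gt0.
pose B : R := (4 * k)%:R / (s * (q / 2) ^+ k.+1).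
(* The group D1 keeps its boxes g; only the other balls are random. *)
have step g :
    mean (fun h =>
      [forall j in S, (occupancy D (paste (~: D1) g h) j < k.+1)%N]%:R)
    <= (#|hit D1 S g|%:R <= s * q / 2 :> R)%R%:R + B.
  have B_ge0 : 0 <= B by rewrite divr_ge0 ?mulr_ge0 ?exprn_ge0// ltW.
  case: (lerP #|hit D1 S g|%:R (s * q / 2)) => [_|many].
    by apply: le_trans (mean_indic_le1 _ _) _; rewrite lerDl.
  rewrite add0r.
  have hit_gt0 : 0 < #|hit D1 S g|%:R :> R.
    by apply: lt_trans many; rewrite divr_gt0.
  apply: (@le_trans _ _ ((4 * k)%:R / (#|hit D1 S g|%:R * (q / 2) ^+ k))).
    apply: le_trans (IHk _ _ cardD2 _); last by rewrite -(ltr0n R).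
    apply: ler_mean => h; rewrite ler_nat.
    case: forall_inP => // few; rewrite lt0b; apply/forall_inP => j.
    rewrite inE => /andP[jS hit_j]; rewrite -ltnS; apply: leq_trans (few j jS).
    rewrite ltnS -(addn1 (occupancy _ _ _)) addnC.
    apply: leq_trans (leq_add hit_j (leqnn _)) _.
    (* A hit box has a ball of D1 besides those of D outside D1. *)
    rewrite /occupancy -cardsUI [X in (_ + X)%N]eq_card0 ?addn0; last first.
      by move=> l; rewrite !inE; case: (l \in D1); rewrite ?andbF.
    apply: subset_leq_card; apply/fintype.subsetP => l; rewrite !inE ffunE inE.
    case: (boolP (l \in D1)) => [lD1|_] /=; last by [].
    by rewrite orbF (fintype.subsetP D1D l lD1).
  rewrite ler_wpM2l// lef_pV2 ?posrE ?mulr_gt0 ?exprn_gt0//.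
  by rewrite exprS mulrA ler_wpM2r ?exprn_ge0 ?ltW// mulrA.
rewrite (mean_paste (~: D1)); apply: le_trans (ler_mean step) _.
rewrite meanD mean_cst// mulnS natrD mulrDl -/B; apply: lerD => //.
have := @hit_concentration D1 S; rewrite cardD1 -/q -/s => conc.
apply: le_trans (conc q_gt0 S_gt0) _; rewrite ler_wpM2l//.
rewrite lef_pV2 ?posrE ?mulr_gt0 ?exprn_gt0//.
rewrite ler_wpM2l ?(ltW s_gt0)// exprS.
have q_le1 : q <= 1 := hit_prob_le1 r.
have : (q / 2) ^+ k <= 1 by rewrite exprn_ile1 ?(ltW q2_gt0)//; lra.
by nra.
Qed.

End Occupancy.

(** * Moments of the cell counts *)

Section CellCounts.
Variables (R : realFieldType) (J : finType) (m : nat).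
Hypothesis J_gt0 : (0 < #|J|)%N.
Implicit Types f : {ffun 'I_m -> J}.

Lemma mean_const_on (K : {set 'I_m}) (x : J) :
  mean (fun f => \prod_(l in K) (f l == x)%:R) = (#|J|%:R ^+ #|K|)^-1 :> R.
Proof.
rewrite (mean_ffun_prod_in _ (fun _ c => (c == x)%:R))// prodr_const.
by rewrite mean_pred1 exprVn.
Qed.

Lemma cell_count_sum f x : (cell_count f x)%:R = \sum_l (f l == x)%:R :> R.
Proof.
rewrite /cell_count -sum1_card natr_sum big_mkcond/=; apply: eq_bigr => l _.
by rewrite inE; case: (_ == _).
Qed.

(** The count is a sum of m pairwise independent indicators, so its variance is
at most its mean m / N. *)
Lemma few_in_cell_prob (x : J) : (0 < m)%N ->
  mean (fun f => ((cell_count f x)%:R <= m%:R / #|J|%:R / 2 :> R)%R%:R)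
  <= 4 * #|J|%:R / m%:R :> R.
Proof.
move=> m_gt0; set mu : R := m%:R / #|J|%:R.
have JR_gt0 : 0 < #|J|%:R :> R by rewrite ltr0n.
have mR_gt0 : 0 < m%:R :> R by rewrite ltr0n.
have -> : 4 * #|J|%:R / m%:R = 4 * mu / mu ^+ 2.
  by rewrite /mu; field; rewrite !gt_eqF.
have mean1 (l : 'I_m) : mean (fun f => (f l == x)%:R) = #|J|%:R^-1 :> R.
  have := mean_const_on [set l] x; rewrite cards1 expr1 => <-.
  by apply: eq_mean => f; rewrite big_set1.
apply: mean_chebyshev; first by rewrite card_ffun expn_gt0 J_gt0.
- by rewrite divr_gt0.
- rewrite (eq_mean (fun f => cell_count_sum f x)) mean_sum.
  rewrite (eq_bigr _ (fun l _ => mean1 l)) sumr_const card_ord.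
  by rewrite -(mulr_natl (_^-1)).
have -> : mean (fun f => (cell_count f x)%:R ^+ 2)
    = \sum_l \sum_l' mean (fun f => (f l == x)%:R * (f l' == x)%:R) :> R.
  rewrite -(eq_bigr _ (fun i _ => mean_sum _ _)) -mean_sum.
  apply: eq_mean => f; rewrite cell_count_sum expr2 mulr_suml.
  by apply: eq_bigr => i _; rewrite mulr_sumr.
have -> : mu ^+ 2 + mu
    = \sum_(l < m) (\sum_(l' < m) (#|J|%:R ^+ 2)^-1 + #|J|%:R^-1).
  rewrite !sumr_const !card_ord -!(mulr_natl (_ + _)) -!(mulr_natl (_^-1)).
  by rewrite /mu; field; rewrite gt_eqF.
apply: ler_sum => l _; rewrite (bigD1 l)//= [X in _ <= X + _](bigD1 l)//=.
rewrite [leRHS]addrAC; apply: lerD; last first.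
  apply: ler_sum => l' ll'; have <- : #|[set l; l']| = 2%N.
    by rewrite cards2 eq_sym ll'.
  rewrite -(mean_const_on _ x); apply: ler_mean => f.
  by rewrite big_setU1 ?inE 1?eq_sym// big_set1.
rewrite -[leLHS]add0r; apply: lerD; first by rewrite invr_ge0 exprn_ge0.
rewrite -(mean1 l); apply: ler_mean => f.
by case: eqP => _; rewrite ?mulr1 ?mulr0.
Qed.

(** The binomial x choose k counts the sets of k balls lying in the cell, and
each such set of balls lies there with probability N^(-k). *)
Lemma mean_bin_cell_count (k : nat) (x : J) :
  mean (fun f => 'C(cell_count f x, k)%:R) = 'C(m, k)%:R / #|J|%:R ^+ k :> R.
Proof.
have -> : mean (fun f => 'C(cell_count f x, k)%:R) = mean (fun f =>
    \sum_(K : {set 'I_m} | #|K| == k) \prod_(l in K) (f l == x)%:R) :> R.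
  apply: eq_mean => f; rewrite /cell_count -cards_draws -sum1_card natr_sum.
  rewrite [LHS]big_mkcond [RHS]big_mkcond/=; apply: eq_bigr => K _.
  rewrite inE andbC; case: (#|K| == k) => //=.
  case: (boolP (K \subset _)) => [/fintype.subsetP sub|/subsetPn[l lK]].
    by rewrite big1// => l /sub; rewrite inE => ->.
  by rewrite inE => /negPf flx; rewrite (bigD1 l)//= flx mul0r.
rewrite mean_sum.
have -> : \sum_(K : {set 'I_m} | #|K| == k)
    mean (fun f => \prod_(l in K) (f l == x)%:R)
    = \sum_(K : {set 'I_m} | #|K| == k) (#|J|%:R ^+ k)^-1 :> R.
  by apply: eq_bigr => K /eqP <-; rewrite mean_const_on.
rewrite sumr_const -(mulr_natl (_^-1)); congr (_%:R * _).
rewrite -[in RHS](card_ord m) -card_draws.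
by apply: eq_card => K; rewrite !inE.
Qed.

End CellCounts.

(** * Upper bound on the best assignment *)

Lemma leq_add_bin (k x : nat) : (x <= k + 'C(x, k.+1))%N.
Proof.
elim: x => // x IHx; case: (leqP x.+1 k) => [le_xk|lt_kx].
  exact: leq_trans le_xk (leq_addr _ _).
rewrite binS addnA -addn1; apply: leq_add => //.
by rewrite bin_gt0.
Qed.

Lemma leq_bin_expn (m k : nat) : ('C(m, k) <= m ^ k)%N.
Proof.
apply: (@leq_trans (m ^_ k)).
  by rewrite -bin_ffact leq_pmulr// fact_gt0.
by elim: k => // k IHk; rewrite ffactnSr expnSr leq_mul// leq_subr.
Qed.

Definition max_assignment (n : nat) (v : 'I_n * 'I_n -> nat) : nat :=
  \max_(s : 'S_n) \sum_(i < n) v (i, s i).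

(** Extending the sum of excesses from the cells of one assignment to all cells
removes the dependence on the assignment. *)
Lemma max_assignment_le (n k : nat) (v : 'I_n * 'I_n -> nat) :
  (max_assignment v <= n * k + \sum_x 'C(v x, k.+1))%N.
Proof.
apply/bigmax_leqP => s _.
apply: (@leq_trans (\sum_(i < n) (k + 'C(v (i, s i), k.+1)))%N).
  by apply: leq_sum => i _; apply: leq_add_bin.
rewrite big_split /= sum_nat_const card_ord leq_add2l.
have -> : (\sum_x 'C(v x, k.+1) = \sum_i \sum_j 'C(v (i, j), k.+1))%N.
  by rewrite pair_bigA; apply: eq_bigr => -[].
by apply: leq_sum => i _; rewrite (bigD1 (s i))//= leq_addr.
Qed.

Lemma mean_max_assignment_le (R : realFieldType) (n m k : nat) : (0 < n)%N ->
  mean (fun f : {ffun 'I_m -> 'I_n * 'I_n} =>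
    (max_assignment (cell_count f))%:R)
  <= n%:R * k%:R + n%:R ^+ 2 * (m%:R / n%:R ^+ 2) ^+ k.+1 :> R.
Proof.
move=> n_gt0; pose C := ('I_n * 'I_n)%type.
have cardC : #|{: C}| = (n ^ 2)%N by rewrite card_prod !card_ord mulnn.
have C_gt0 : (0 < #|{: C}|)%N by rewrite cardC expn_gt0 n_gt0.
apply: (@le_trans _ _ (mean (fun f : {ffun 'I_m -> C} =>
    (n * k)%:R + \sum_x 'C(cell_count f x, k.+1)%:R))).
  apply: ler_mean => f; rewrite -natr_sum -natrD ler_nat.
  exact: max_assignment_le.
rewrite meanD mean_cst ?card_ffun ?expn_gt0 ?C_gt0// natrM lerD2l.
rewrite mean_sum (eq_bigr _ (fun x _ => mean_bin_cell_count _ _ C_gt0 k.+1 x)).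
rewrite sumr_const -(mulr_natl (_ / _)) cardC natrX ler_wpM2l ?exprn_ge0//.
rewrite expr_div_n ler_wpM2r ?invr_ge0 ?exprn_ge0//.
by rewrite -natrX ler_nat leq_bin_expn.
Qed.

(** * Greedy assignment *)

Section Greedy.
Variable n : nat.
Implicit Types (B : 'I_n -> 'I_n -> bool) (s : 'S_n).

(** The positions j >= i of s hold the columns that are still free at row i. Row i
swaps a good free column into position i when there is one, and otherwise keeps
the column s i, so that every row uses up exactly one column. *)
Definition greedy_step B s (i : 'I_n) : 'S_n :=
  if [pick j : 'I_n | (i <= j)%N && B i (s j)] is Some j
  then (tperm i j * s)%g else s.

Fixpoint greedy B (t : nat) : 'S_n :=
  if t is u.+1 then
    if insub u is Some i then greedy_step B (greedy B u) i else greedy B u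
  else 1%g.

Definition unused B (i : 'I_n) : {set 'I_n} :=
  [set greedy B i j | j : 'I_n & (i <= j)%N].

(** The choices made before row t depend on the rows before t only; this is
what makes the next row independent of them. *)
Lemma eq_greedy B B' (t : nat) :
  (forall i j : 'I_n, (i < t)%N -> B i j = B' i j) -> greedy B t = greedy B' t.
Proof.
elim: t => //= t IHt BB'; rewrite IHt; last first.
  by move=> i j it; apply: BB'; apply: ltnW.
case: insubP => // i _ it; rewrite /greedy_step.
rewrite (@eq_pick _ _ (fun j : 'I_n => (i <= j)%N && B' i (greedy B' t j)))//.
by move=> j /=; rewrite BB'// it.
Qed.

(** Later steps only permute later positions. *)
Lemma greedy_stable B (t u : nat) (i : 'I_n) :
  (i < t)%N -> (t <= u)%N -> greedy B u i = greedy B t i.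
Proof.
move=> it; elim: u => [|u IHu]; first by rewrite leqn0 => /eqP->.
rewrite leq_eqVlt => /predU1P[<-//|]; rewrite ltnS => tu; rewrite -IHu//=.
case: insubP => // i' _ i'u; rewrite /greedy_step.
case: pickP => // j /andP[i'j _]; rewrite permM tpermD//.
  by apply: contraTneq it => <-; rewrite i'u -leqNgt.
by apply: contraTneq it => <-; rewrite -leqNgt (leq_trans tu)// -i'u.
Qed.

Lemma greedy_success B (i : 'I_n) :
  [exists c in unused B i, B i c] -> B i (greedy B n i).
Proof.
move=> /exists_inP[c /imsetP[j]]; rewrite inE => ij -> Bij.
rewrite (greedy_stable B (ltnSn i) (ltn_ord i)) /= valK /greedy_step.
case: pickP => [j' /andP[_ Bij']|/(_ j)]; last by rewrite ij Bij.
by rewrite permM tpermL.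
Qed.

Lemma card_unused B (i : 'I_n) : #|unused B i| = (n - i)%N.
Proof.
rewrite card_imset; last exact: perm_inj.
transitivity (\sum_(i <= j < n) 1)%N; last by rewrite sum_nat_const_nat muln1.
by rewrite -sum1_card big_geq_mkord; apply: eq_bigl => j; rewrite inE.
Qed.

Lemma max_assignment_ge B (k : nat) (v : 'I_n * 'I_n -> nat) :
  (forall i j, B i j -> (k <= v (i, j))%N) ->
  (\sum_(i < n) k * [exists c in unused B i, B i c] <= max_assignment v)%N.
Proof.
move=> Bv; apply: (bigop.bigmax_sup (greedy B n)) => //.
apply: leq_sum => i _; case: (boolP [exists c in _, _]); last by rewrite muln0.
by move=> /greedy_success/Bv; rewrite muln1.
Qed.

End Greedy.

(** * Lower bound on the best assignment *)

Section LowerBound.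
Variables (R : realFieldType) (n m k : nat).
Implicit Types (r g : {ffun 'I_m -> 'I_n}).

Definition row_balls r (i : 'I_n) : {set 'I_m} := [set l | r l == i].

(** With r the rows and g the columns of the balls: the cells with at least k
balls. *)
Definition full_cells r g (i j : 'I_n) : bool :=
  (k <= occupancy (row_balls r i) g j)%N.

Definition row_fails r g (i : 'I_n) : bool :=
  [forall c in unused (full_cells r g) i,
    (occupancy (row_balls r i) g c < k)%N].

Lemma occupancy_paste (I J : finType) (D D' : {set I}) (g h : {ffun I -> J}) j :
  [disjoint D' & D] -> occupancy D' (paste D g h) j = occupancy D' g j.
Proof.
move=> dis; apply: eq_card => l; rewrite !inE ffunE.
by case: (boolP (l \in D')) => //= lD'; rewrite (disjointFr dis lD').
Qed.

(** Resampling the columns of the balls in row i changes neither the earlier rows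
nor, therefore, the set of unused columns, which has n - i elements; the bound on
full boxes applies to that fixed set. *)
Lemma row_fails_prob_given_rows (b : nat) r (i : 'I_n) :
  0 < hit_prob R 'I_n b -> (k * b <= #|row_balls r i|)%N ->
  mean (fun g => (row_fails r g i)%:R)
  <= (4 * k)%:R / ((n - i)%:R * (hit_prob R 'I_n b / 2) ^+ k) :> R.
Proof.
move=> q_gt0 balls; rewrite (mean_paste (row_balls r i)).
have G_gt0 : (0 < #|{ffun 'I_m -> 'I_n}|)%N.
  by rewrite card_ffun expn_gt0 card_ord (leq_ltn_trans _ (ltn_ord i)).
rewrite -[leRHS](mean_cst _ G_gt0); apply: ler_mean => g.
rewrite -(card_unused (full_cells r g) i).
apply: le_trans (mean_no_full_box q_gt0 balls _); last first.
  by rewrite card_unused subn_gt0.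
apply: ler_mean => h; rewrite ler_nat leq_eqVlt; apply/orP; left; apply/eqP.
congr nat_of_bool; rewrite /row_fails.
have -> : unused (full_cells r (paste (row_balls r i) g h)) i
    = unused (full_cells r g) i.
  rewrite /unused (@eq_greedy _ _ (full_cells r g))// => i' j i'i.
  rewrite /full_cells occupancy_paste//.
  apply/pred0P => l; rewrite !inE; case: eqP => //= ->.
  by apply/eqP => ii'; rewrite ii' ltnn in i'i.
apply: eq_forallb => c; congr (_ ==> (_ < _)%N).
by apply: eq_card => l; rewrite !inE ffunE inE; case: eqP.
Qed.

(** Row i receives m / n balls on average, hence more than m / (2 n) of them,
enough for k groups of b balls, except with probability 4 n / m. *)
Lemma row_fails_prob (b : nat) (i : 'I_n) :
  (0 < m)%N -> (0 < k)%N -> b = (m %/ (2 * n * k))%N ->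
  0 < hit_prob R 'I_n b ->
  mean (fun r => mean (fun g => (row_fails r g i)%:R))
  <= 4 * n%:R / m%:R
     + (4 * k)%:R / ((n - i)%:R * (hit_prob R 'I_n b / 2) ^+ k) :> R.
Proof.
move=> m_gt0 k_gt0 bE q_gt0; set A := (X in _ <= _ + X).
have n_gt0 : (0 < n)%N by apply: leq_ltn_trans (ltn_ord i).
have J_gt0 : (0 < #|'I_n|)%N by rewrite card_ord.
have A_ge0 : 0 <= A.
  by rewrite divr_ge0// mulr_ge0// exprn_ge0// divr_ge0// ltW.
apply: (@le_trans _ _ (mean (fun r : {ffun 'I_m -> 'I_n} =>
    ((cell_count r i)%:R <= m%:R / #|'I_n|%:R / 2 :> R)%R%:R + A))).
  apply: ler_mean => r.
  case: (lerP (cell_count r i)%:R (m%:R / #|'I_n|%:R / 2)) => [_|many].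
    by apply: le_trans (mean_indic_le1 _ _) _; rewrite lerDl.
  rewrite add0r; apply: row_fails_prob_given_rows => //.
  have -> : row_balls r i = [set l | r l == i] by [].
  rewrite -/(cell_count r i) -(ler_nat R); apply: le_trans (ltW many).
  rewrite card_ord -mulrA -invfM ler_pdivlMr ?mulr_gt0 ?ltr0n//.
  rewrite -!natrM ler_nat.
  have -> : (k * b * (n * 2) = b * (2 * n * k))%N by ring.
  by rewrite bE leq_trunc_div.
rewrite meanD mean_cst; last by rewrite card_ffun expn_gt0 J_gt0.
by rewrite lerD2r -[in leRHS](card_ord n) few_in_cell_prob.
Qed.

Lemma sum_short_tail (s : nat) : (\sum_(i < n) (n - i <= s) <= s)%N.
Proof.
rewrite (reindex_inj rev_ord_inj)/=.
have -> : (\sum_(i < n) (n - (n - i.+1) <= s) = \sum_(i < n) (i < s))%N.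
  by apply: eq_bigr => i _; rewrite subKn.
have -> : (\sum_(i < n) (i < s) = minn n s)%N; last exact: geq_minr.
elim: (n) => [|u IHu]; first by rewrite big_ord0 min0n.
rewrite big_ord_recr/= IHu; case: (ltnP u s) => us.
  by rewrite (minn_idPl us) addn1.
by rewrite (minn_idPr (leqW us)) addn0.
Qed.

(** The last s rows, for which few columns are left, are given up; for the others
at least s columns are free. *)
Lemma mean_max_assignment_ge (s b : nat) :
  (0 < m)%N -> (0 < k)%N -> (0 < s)%N -> b = (m %/ (2 * n * k))%N ->
  0 < hit_prob R 'I_n b ->
  k%:R * (n%:R - s%:R - n%:R * (4 * n%:R / m%:R
     + (4 * k)%:R / (s%:R * (hit_prob R 'I_n b / 2) ^+ k)))
  <= mean (fun f : {ffun 'I_m -> 'I_n * 'I_n} =>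
    (max_assignment (cell_count f))%:R) :> R.
Proof.
move=> m_gt0 k_gt0 s_gt0 bE q_gt0; set C := (X in _ - _ * X).
have [n0|n_gt0] := posnP n.
  rewrite n0 !mul0r subr0 sub0r mulrN; apply: le_trans (mean_ge0 _) => //.
have G_gt0 : (0 < #|{ffun 'I_m -> 'I_n}|)%N.
  by rewrite card_ffun expn_gt0 card_ord n_gt0.
rewrite mean_ffun_pair.
have nE : n%:R = \sum_(i < n) 1 :> R by rewrite sumr_const card_ord.
pose fail r g := \sum_(i < n) (row_fails r g i)%:R : R.
apply: (@le_trans _ _ (mean (fun r => mean (fun g =>
    k%:R * (n%:R - fail r g))))); last first.
  apply: ler_mean => r; apply: ler_mean => g.
  set f := [ffun l => _].
  have cell_countE i j : cell_count f (i, j) = occupancy (row_balls r i) g j.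
    by apply: eq_card => l; rewrite !inE ffunE xpair_eqE.
  have full_count i j : full_cells r g i j -> (k <= cell_count f (i, j))%N.
    by rewrite cell_countE.
  have := max_assignment_ge full_count; rewrite -(ler_nat R).
  apply: le_trans; rewrite natr_sum nE /fail -sumrB.
  rewrite mulr_sumr; apply: ler_sum => i _; rewrite natrM ler_wpM2l//.
  rewrite /row_fails; case: forall_inP => [_|nfail]; first by rewrite subrr.
  rewrite subr0 ler1n lt0b; apply: contra_notT nfail.
  by move=> /exists_inPn none c c_unused; rewrite ltnNge; apply: none.
have -> : mean (fun r => mean (fun g => k%:R * (n%:R - fail r g)))
    = k%:R * (n%:R - \sum_(i < n) mean (fun r => mean (fun g =>
        (row_fails r g i)%:R))) :> R.
  rewrite -mean_sum.
  transitivity (mean (fun r => k%:R * (n%:R - mean (fail r)))); last first.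
    rewrite meanZ meanB mean_cst//; congr (_ * (_ - _)).
    by apply: eq_mean => r; rewrite mean_sum.
  by apply: eq_mean => r; rewrite meanZ meanB mean_cst.
rewrite ler_wpM2l// -addrA -opprD lerD2l lerN2.
apply: (@le_trans _ _ (\sum_(i < n) ((n - i <= s)%N%:R + C))).
  apply: ler_sum => i _; case: leqP => [_|long].
    apply: (@le_trans _ _ 1); last first.
      rewrite lerDl addr_ge0 ?divr_ge0 ?mulr_ge0 ?exprn_ge0 ?divr_ge0//.
      exact: ltW.
    rewrite -[leRHS](mean_cst _ G_gt0); apply: ler_mean => r.
    exact: mean_indic_le1.
  rewrite add0r; apply: le_trans (row_fails_prob _ m_gt0 k_gt0 bE q_gt0) _.
  have qk_gt0 : 0 < (hit_prob R 'I_n b / 2) ^+ k.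
    by rewrite exprn_gt0// divr_gt0.
  rewrite lerD2l ler_wpM2l// lef_pV2 ?posrE ?mulr_gt0 ?ltr0n ?subn_gt0//.
  by rewrite ler_wpM2r ?(ltW qk_gt0)// ler_nat ltnW.
rewrite big_split/= sumr_const card_ord -(mulr_natl C) lerD2r -natr_sum ler_nat.
exact: sum_short_tail.
Qed.

End LowerBound.

(** * From the multinomial law to uniform averages *)

Section Transfer.
Local Open Scope classical_set_scope.
Variables (d : measure_display) (T : measurableType d) (R : realType).
Variables (P : probability T R) (C : finType) (m : nat).
Variable X : C -> {RV P >-> nat}.
Hypothesis C_gt0 : (0 < #|C|)%N.
Hypothesis X_law : multinomial_law m X.

Definition outcome (v : C -> nat) : set T := [set t | forall x, X x t = v x].

Lemma measurable_outcome v : measurable (outcome v).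
Proof.
rewrite (_ : outcome v = \bigcap_(x in [set: C]) (X x @^-1` [set v x])).
  apply: fin_bigcap_measurable => [|x _]; first exact: finite_finset.
  exact: measurable_funPTI.
by apply/seteqP; split => t /= Xt => [x _|x]; exact: Xt.
Qed.

(** The counts take values in a countable set, so every function of them is
measurable. *)
Lemma measurable_fun_of_counts (G : (C -> nat) -> R) :
  measurable_fun [set: T] (fun t => G (fun x => X x t)).
Proof.
move=> _ B mB; rewrite setTI.
rewrite (_ : _ @^-1` B = \bigcup_(v : {ffun C -> nat})
    (if `[< B (G v) >] then outcome v else set0)).
  apply: countable_bigcupT_measurable => [|v]; first exact: countableP.
  by case: ifP => // _; exact: measurable_outcome.
apply/seteqP; split => [t /= Bt|t [v _]].
  exists [ffun x => X x t] => //.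
  have E : ([ffun x => X x t] : C -> nat) = (fun x => X x t).
    by apply/funext => x; rewrite ffunE.
  by rewrite E asboolT// => x; rewrite ffunE.
case: asboolP => // Bv /funext Xt; rewrite /= (_ : (fun x => X x t) = v)//.
Qed.

Lemma sum_multinomial_pmf (G : (C -> nat) -> R) :
  \sum_(v : {ffun C -> 'I_m.+1})
    G (fun x => v x) * multinomial_pmf R m (fun x => v x)
  = mean (fun f : {ffun 'I_m -> C} => G (cell_count f)).
Proof.
pose counts (f : {ffun 'I_m -> C}) : {ffun C -> 'I_m.+1} :=
  [ffun x => inord (cell_count f x)].
have countsE f x : counts f x = cell_count f x :> nat.
  by rewrite ffunE inordK// ltnS -[leqRHS]card_ord max_card.
rewrite /mean (partition_big counts predT)//= mulr_suml; apply: eq_bigr => v _.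
rewrite /multinomial_pmf card_ffun card_ord mulrA; congr (_ / _).
have -> : \sum_(f | counts f == v) G (cell_count f)
    = \sum_(f | counts f == v) G (fun x => v x).
  apply: eq_bigr => f /eqP <-; congr G; apply/funext => x; exact/esym.
rewrite sumr_const -(mulr_natr (G _)); congr (_ * _%:R).
apply: eq_card => f; rewrite inE; transitivity (counts f == v); last by [].
apply/forallP/idP => [fv|/eqP/ffunP fv x].
  by apply/eqP/ffunP => x; apply: val_inj; rewrite /= countsE; apply/eqP.
by rewrite -fv countsE.
Qed.

(** The simple function that agrees with G of the counts on the outcomes in which
all counts are at most m. The law gives these outcomes probability 1, but says
nothing about individual points of T. *)
Definition simple_of_counts (G : (C -> nat) -> R) (t : T) : R :=
  \sum_(v : {ffun C -> 'I_m.+1})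
    G (fun x => v x) * \1_(outcome (fun x => v x)) t.

Lemma integral_simple_of_counts (G : (C -> nat) -> R) : (forall v, 0 <= G v) ->
  (\int[P]_t (simple_of_counts G t)%:E)%E
  = (mean (fun f : {ffun 'I_m -> C} => G (cell_count f)))%:E.
Proof.
move=> G_ge0; rewrite /simple_of_counts.
under eq_integral do rewrite -sumEFin.
rewrite ge0_integral_sum//=; last 2 first.
- move=> v; apply/measurable_EFinP; apply: measurable_funM => //.
  exact/measurable_indic/measurable_outcome.
- by move=> v t _; rewrite lee_fin mulr_ge0.
rewrite -sum_multinomial_pmf -sumEFin; apply: eq_bigr => v _.
under eq_integral do rewrite EFinM.
rewrite ge0_integralZl_EFin//; last first.
  by apply/measurable_EFinP/measurable_indic/measurable_outcome.
rewrite integral_indic//; last exact: measurable_outcome.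
by rewrite setIT EFinM; congr (_ * _)%E; exact: X_law.
Qed.

Lemma simple_of_countsE (G : (C -> nat) -> R) (v : {ffun C -> 'I_m.+1}) t :
  outcome (fun x => v x) t -> simple_of_counts G t = G (fun x => X x t).
Proof.
move=> vt; rewrite /simple_of_counts (bigD1 v)//= big1 => [|w w_neq_v].
  rewrite indicE mem_set// mulr1 addr0; congr G.
  by apply/funext => x; exact/esym/vt.
rewrite indicE memNset ?mulr0// => wt; case/eqP: w_neq_v; apply/ffunP => x.
by apply: val_inj; rewrite /= -vt -wt.
Qed.

Lemma expectation_multinomial (G : (C -> nat) -> R) : (forall v, 0 <= G v) ->
  ('E_P[fun t => G (fun x => X x t)])%E
  = (mean (fun f : {ffun 'I_m -> C} => G (cell_count f)))%:E.
Proof.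
move=> G_ge0; rewrite unlock -integral_simple_of_counts//.
have m_simple (H : (C -> nat) -> R) :
    measurable_fun [set: T] (simple_of_counts H).
  apply: measurable_sum => v; apply: measurable_funM => //.
  exact/measurable_indic/measurable_outcome.
have s_ge0 (H : (C -> nat) -> R) t :
    (forall v, 0 <= H v) -> 0 <= simple_of_counts H t.
  by move=> H0; apply: sumr_ge0 => v _; rewrite mulr_ge0.
pose U := \bigcup_(v : {ffun C -> 'I_m.+1}) outcome (fun x => v x).
have mU : measurable U.
  apply: countable_bigcupT_measurable => [|v]; first exact: countableP.
  exact: measurable_outcome.
(* Apply the integral formula to the constant 1, for which the simple function
   is the indicator of U. *)
have PU : P U = 1%E.
  have <- : (\int[P]_t (simple_of_counts (fun=> 1) t)%:E)%E = 1%E.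
    by rewrite integral_simple_of_counts// mean_cst// card_ffun expn_gt0 C_gt0.
  rewrite -[U in LHS]setIT -integral_indic//; apply: eq_integral => t _.
  rewrite indicE; case: (boolP (t \in U)) => [/set_mem[v _ vt]|/negP tU].
    by rewrite (simple_of_countsE _ vt).
  rewrite /simple_of_counts big1// => v _.
  rewrite indicE memNset ?mulr0// => vt.
  by apply/tU/mem_set; exists v.
apply: ge0_ae_eq_integral => //.
- exact/measurable_EFinP/measurable_fun_of_counts.
- exact/measurable_EFinP/m_simple.
- by move=> t _; rewrite lee_fin.
- by move=> t _; rewrite lee_fin s_ge0.
exists (~` U); split; first exact: measurableC.
- by have := probability_setC P mU; rewrite PU subee.
move=> t; apply: contra_not => -[v _ vt] _ /=.
by rewrite (simple_of_countsE G vt).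
Qed.

End Transfer.

(** * The lower bound in terms of the density mu *)

Section DensityBound.
Variable R : realFieldType.

(** From (1 - x)(1 + (r+1) x) <= 1 + r x. *)
Lemma bernoulli_inv (x : R) (r : nat) : 0 <= x <= 1 ->
  (1 - x) ^+ r * (1 + r%:R * x) <= 1.
Proof.
move=> /andP[x0 x1]; elim: r => [|r IHr].
  by rewrite expr0 mul0r addr0 mulr1.
apply: le_trans IHr; rewrite exprS mulrC mulrA mulrC ler_wpM2l//.
  by rewrite exprn_ge0// subr_ge0.
by rewrite -natr1; have : 0 <= r%:R :> R by []; nra.
Qed.

Lemma hit_prob_ge (n r : nat) : (0 < n)%N -> (r <= n)%N ->
  r%:R / n%:R / 2 <= hit_prob R 'I_n r.
Proof.
move=> n_gt0 rn; rewrite /hit_prob card_ord.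
have nR_gt0 : 0 < n%:R :> R by rewrite ltr0n.
have V01 : 0 <= (n%:R^-1 : R) <= 1.
  by rewrite invr_ge0 ler0n invf_le1// ler1n.
have := bernoulli_inv r V01; set y := _ ^+ r; set t := r%:R / n%:R.
have y_ge0 : 0 <= y by rewrite exprn_ge0// subr_ge0; case/andP: V01.
have t_ge0 : 0 <= t by rewrite divr_ge0.
have t_le1 : t <= 1 by rewrite ler_pdivrMr// mul1r ler_nat.
by nra.
Qed.

(** Here the groups have b = m / (2 n k) balls, rounded down. The condition on
n mu makes the rounding cost at most half, so that b / n >= mu / (4 k) and the
hitting probability q satisfies q / 2 >= mu / (16 k); the condition mu <= 1
ensures b <= n, which keeps q comparable to b / n. *)
Lemma mean_max_assignment_lb (n m k : nat) (eps : R) (s : nat) :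
  (0 < n)%N -> (0 < m)%N -> (0 < k)%N -> 0 < eps ->
  eps * n%:R <= s%:R <= eps * n%:R + 1 ->
  let mu : R := m%:R / n%:R ^+ 2 in
  mu <= 1 -> 4 * k%:R <= n%:R * mu ->
  k%:R * n%:R * (1 - (eps + n%:R^-1 + 4 * (n%:R * mu)^-1
      + (4 * k)%:R * (16 * k%:R) ^+ k / eps * (n%:R * mu ^+ k)^-1))
  <= mean (fun f : {ffun 'I_m -> 'I_n * 'I_n} =>
    (max_assignment (cell_count f))%:R).
Proof.
move=> n_gt0 m_gt0 k_gt0 eps_gt0 /andP[s_ge s_le] mu mu_le1 mu_ge.
have nR_gt0 : 0 < n%:R :> R by rewrite ltr0n.
have mR_gt0 : 0 < m%:R :> R by rewrite ltr0n.
have kR_gt0 : 0 < k%:R :> R by rewrite ltr0n.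
have mu_gt0 : 0 < mu by rewrite divr_gt0// exprn_gt0.
have s_gt0 : 0 < s%:R :> R by apply: lt_le_trans s_ge; rewrite mulr_gt0.
have mE : m%:R = mu * n%:R ^+ 2 by rewrite /mu divfK// gt_eqF// exprn_gt0.
pose b := (m %/ (2 * n * k))%N.
pose z : R := (2 * n * k)%:R.
have zE : z = 2 * n%:R * k%:R by rewrite /z !natrM.
have z_gt0 : 0 < z by rewrite ltr0n !muln_gt0 n_gt0 k_gt0.
have bz_le : b%:R * z <= m%:R by rewrite -natrM ler_nat leq_trunc_div.
have bz_gt : m%:R < b%:R * z + z.
  rewrite -{2}[z]mul1r -mulrDl natr1 -natrM ltr_nat ltn_ceil//.
  by rewrite !muln_gt0 n_gt0 k_gt0.
have bn : (b <= n)%N.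
  rewrite -(ler_nat R) -(ler_pM2r z_gt0); apply: le_trans bz_le _.
  rewrite mE zE; have : 1 <= k%:R :> R by rewrite ler1n.
  by move=> k1; have := ler_wpM2r (sqr_ge0 n%:R) mu_le1; rewrite mul1r; nra.
have b_ge : mu / (4 * k%:R) <= b%:R / n%:R.
  rewrite ler_pdivlMr// mulrAC ler_pdivrMr ?mulr_gt0//.
  have : z <= m%:R / 2 by rewrite zE mE; nra.
  by move: bz_gt; rewrite mE zE => h1 h2; nra.
have q_ge : mu / (16 * k%:R) <= hit_prob R 'I_n b / 2.
  have -> : mu / (16 * k%:R) = mu / (4 * k%:R) / 2 / 2 by field; rewrite gt_eqF.
  rewrite ler_pM2r ?invr_gt0//; apply: le_trans (hit_prob_ge n_gt0 bn).
  by rewrite ler_pM2r ?invr_gt0.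
have q0_gt0 : 0 < mu / (16 * k%:R) by rewrite divr_gt0// mulr_gt0.
have q_gt0 : 0 < hit_prob R 'I_n b.
  by have := lt_le_trans q0_gt0 q_ge; rewrite pmulr_lgt0// invr_gt0.
have sN : (0 < s)%N by rewrite -(ltr0n R).
apply: le_trans (mean_max_assignment_ge m_gt0 k_gt0 sN erefl q_gt0).
rewrite -mulrA ler_pM2l//.
set q := (hit_prob _ _ _ / 2) ^+ k.
pose A : R := (4 * k)%:R * (16 * k%:R) ^+ k / eps * (n%:R * mu ^+ k)^-1.
have A_ge : (4 * k)%:R / (s%:R * q) <= A.
  have -> : A = (4 * k)%:R / (eps * n%:R * (mu / (16 * k%:R)) ^+ k).
    have y_gt0 : 0 < (16 * k%:R : R) ^+ k by rewrite exprn_gt0 ?mulr_gt0.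
    have x_gt0 : 0 < mu ^+ k by rewrite exprn_gt0.
    rewrite /A (expr_div_n mu); move: y_gt0 x_gt0.
    move: (_ ^+ k) (mu ^+ k) => y x y_gt0 x_gt0.
    by field; rewrite !gt_eqF.
  rewrite ler_wpM2l// lef_pV2 ?posrE ?mulr_gt0 ?exprn_gt0//; last first.
    by rewrite divr_gt0.
  have q0_ge0 := ltW q0_gt0.
  apply: ler_pM => //; first by rewrite mulr_ge0// ltW.
    by rewrite exprn_ge0.
  by apply: lerXn2r => //; rewrite nnegrE (le_trans q0_ge0).
have nm : 4 * n%:R / m%:R = 4 * (n%:R * mu)^-1.
  by rewrite mE; field; rewrite !gt_eqF.
rewrite nm -/A; set B := 4 * _^-1.
have -> : n%:R * (1 - (eps + n%:R^-1 + B + A))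
    = n%:R - (eps * n%:R + 1) - n%:R * (B + A) by field; rewrite gt_eqF.
have := ler_wpM2l (ltW nR_gt0) A_ge; move: s_le.
by rewrite !(mulrDr n%:R B); lra.
Qed.

End DensityBound.

(** * Asymptotics *)

Section Asymptotics.
Local Open Scope classical_set_scope.
Variable R : realType.

Lemma cvg_natpowRN (b : R) : 0 < b -> (n%:R `^ (- b)) @[n --> \oo] --> (0 : R).
Proof.
move=> b_gt0.
have -> : (fun n : nat => n%:R `^ (- b))
    = (fun n : nat => (n%:R `^ b)^-1) :> (nat -> R).
  by apply/funext => n; rewrite powRN.
apply/gtr0_cvgV0.
  near=> n; rewrite powR_gt0// ltr0n; near: n; exact: nbhs_infty_gt.
apply/cvgryPge => A; near=> n.
apply: (@le_trans _ _ (Num.max A 0)); first by rewrite le_max lexx.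
set M := Num.max A 0.
have M_ge0 : 0 <= M by rewrite le_max lexx orbT.
have -> : M = (M `^ b^-1) `^ b by rewrite -powRrM mulVf ?gt_eqF// powRr1.
apply: ge0_ler_powR; rewrite ?nnegrE ?powR_ge0 ?(ltW b_gt0)//.
near: n; exact: nbhs_infty_ger.
Unshelve. all: by end_near. Qed.

Variables (c a : R) (mu e : nat -> R).
Hypothesis c_gt0 : 0 < c.
Hypothesis e_cvg : e n @[n --> \oo] --> (0 : R).
Hypothesis mu_e : \forall n \near \oo, mu n = c * n%:R `^ (- a) * (1 + e n).

Let u n := c * (1 + e n).

Lemma cvg_u : u n @[n --> \oo] --> c.
Proof.
suff : u n @[n --> \oo] --> c * (1 + 0) by rewrite addr0 mulr1.
by apply: cvgM; [exact: cvg_cst|apply: cvgD => //; exact: cvg_cst].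
Qed.

(** Both n mu^(k+1) -> 0 and n mu^k -> oo are read off from this formula, by the
sign of the exponent 1 - a j. *)
Lemma natM_mu_expr (j : nat) :
  \forall n \near \oo, n%:R * mu n ^+ j = n%:R `^ (1 - a * j%:R) * u n ^+ j.
Proof.
near=> n.
have n_gt0 : (0 < n)%N by near: n; exact: nbhs_infty_gt.
have nR : (0 : R) < n%:R by rewrite ltr0n.
have -> : mu n = c * n%:R `^ (- a) * (1 + e n) by near: n.
rewrite powRD; last by rewrite (gt_eqF nR) implybT.
rewrite powRr1 ?ltW// -mulNr powRrM powR_mulrn ?powR_ge0// /u !exprMn.
by ring.
Unshelve. all: by end_near. Qed.

Lemma cvg_natM_mu_expr (j : nat) : 1 < a * j%:R ->
  n%:R * mu n ^+ j @[n --> \oo] --> (0 : R).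
Proof.
move=> aj.
apply: (@cvg_trans _ ((n%:R `^ (1 - a * j%:R) * u n ^+ j) @[n --> \oo])).
  apply: near_eq_cvg; near=> n; apply/esym; near: n; exact: natM_mu_expr.
rewrite -(mul0r (c ^+ j)); apply: cvgM.
  2: exact: (continuous_cvg _ (@exprn_continuous R j c) cvg_u).
by rewrite -opprB; apply: cvg_natpowRN; rewrite subr_gt0.
Unshelve. all: by end_near. Qed.

Lemma cvg_natM_mu_exprV (j : nat) : a * j%:R < 1 ->
  (n%:R * mu n ^+ j)^-1 @[n --> \oo] --> (0 : R).
Proof.
move=> aj.
apply: (@cvg_trans _
  ((n%:R `^ (- (1 - a * j%:R)) * (u n ^+ j)^-1) @[n --> \oo])).
  apply: near_eq_cvg; near=> n; rewrite powRN -invfM; congr (_^-1).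
  by apply/esym; near: n; exact: natM_mu_expr.
rewrite -(mul0r (c ^+ j)^-1); apply: cvgM.
  by apply: cvg_natpowRN; rewrite subr_gt0.
apply: cvgV; first by rewrite expf_neq0// gt_eqF.
exact: (continuous_cvg _ (@exprn_continuous R j c) cvg_u).
Unshelve. all: by end_near. Qed.

Lemma cvg_mu : 0 < a -> mu n @[n --> \oo] --> (0 : R).
Proof.
move=> a_gt0.
apply: (@cvg_trans _ ((n%:R `^ (- a) * u n) @[n --> \oo])).
  apply: near_eq_cvg; near=> n.
  rewrite (_ : mu n = c * n%:R `^ (- a) * (1 + e n)).
    by rewrite /u; ring.
  by near: n.
by rewrite -(mul0r c); apply: cvgM; [exact: cvg_natpowRN|exact: cvg_u].
Unshelve. all: by end_near. Qed.

End Asymptotics.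

Local Open Scope classical_set_scope.

(** k is the integer part of 1/a. *)
Lemma unit_fraction_gap (R : realType) (a : R) : 0 < a < 1 ->
  (forall k : nat, (0 < k)%N -> a <> 1 / k%:R) ->
  exists k : nat,
    unique (fun j : nat => (0 < j)%N /\ 1 / (j%:R + 1) < a < 1 / j%:R) k.
Proof.
move=> /andP[a_gt0 a_lt1] a_notin; pose k := Num.truncn a^-1.
have V_gt1 : 1 < a^-1 by rewrite invf_gt1.
have [k_le k_gt] : k%:R <= a^-1 /\ a^-1 < k.+1%:R.
  by apply/andP; rewrite truncn_itv// ltW// invr_gt0.
have k_gt0 : (0 < k)%N by rewrite truncn_gt0 ltW.
exists k; split.
  split=> //; apply/andP; split.
    by rewrite mul1r natr1 -[a in _ < a]invrK ltf_pV2 ?posrE ?invr_gt0 ?ltr0n.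
  rewrite lt_neqAle; apply/andP; split; first exact/eqP/a_notin.
  by rewrite mul1r -[a]invrK lef_pV2 ?posrE ?invr_gt0 ?ltr0n.
move=> j [j_gt0 /andP[]]; rewrite !mul1r natr1 => lt_ja lt_aj.
have j_lt : j%:R < a^-1.
  by rewrite -[j%:R]invrK ltf_pV2 ?posrE ?invr_gt0 ?ltr0n.
have j_gt : a^-1 < j.+1%:R.
  by rewrite -[j.+1%:R]invrK ltf_pV2 ?posrE ?invr_gt0 ?ltr0n.
apply/eqP; rewrite eqn_leq -(ltnS k) -(ltnS j) -!(ltr_nat R).
by rewrite (le_lt_trans k_le j_gt) (lt_trans j_lt k_gt).
Qed.

(** The four error terms of the lower bound are each made at most eps / 4; the
upper bound has a single one. *)
Lemma cvg_mean_max_assignment (R : realType) (c a : R) (m : nat -> nat)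
    (e : nat -> R) (k : nat) :
  0 < c -> 0 < a -> a < 1 -> (0 < k)%N -> 1 / (k%:R + 1) < a < 1 / k%:R ->
  (forall n, (2 <= n)%N -> (0 < m n)%N) ->
  e n @[n --> \oo] --> (0 : R) ->
  (\forall n \near \oo,
     (m n)%:R * n%:R ^- 2 = c * n%:R `^ (- a) * (1 + e n)) ->
  (mean (fun f : {ffun 'I_(m n) -> 'I_n * 'I_n} =>
     (max_assignment (cell_count f))%:R) / (k%:R * n%:R))
    @[n --> \oo] --> (1 : R).
Proof.
move=> c_gt0 a_gt0 a_lt1 k_gt0 /andP[a_gt a_lt] m_gt0 e_cvg mu_e.
pose mu (n : nat) : R := (m n)%:R / n%:R ^+ 2.
have kR_gt0 : 0 < k%:R :> R by rewrite ltr0n.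
have ak : a * k%:R < 1 by rewrite -ltr_pdivlMr.
have ak1 : 1 < a * k.+1%:R by rewrite -natr1 -ltr_pdivrMr// ltr_pwDr.
have a1 : a * 1%:R < 1 by rewrite mulr1.
have cvg_up := cvg_natM_mu_expr e_cvg mu_e ak1.
have cvg_lo := cvg_natM_mu_exprV c_gt0 e_cvg mu_e ak.
have cvg_row := cvg_natM_mu_exprV c_gt0 e_cvg mu_e a1.
have cvg_mu0 := cvg_mu e_cvg mu_e a_gt0.
have cvg_n := @cvg_natpowRN R 1 ltr01.
apply/cvgrPdist_le => eps eps_gt0.
pose B : R := (4 * k)%:R * (16 * k%:R) ^+ k / (eps / 4).
have eps4_gt0 : 0 < eps / 4 by rewrite divr_gt0.
have B_gt0 : 0 < B.
  by rewrite divr_gt0// mulr_gt0 ?exprn_gt0 ?mulr_gt0// ltr0n muln_gt0.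
have row_small (delta : R) : 0 < delta ->
    \forall n \near \oo, (n%:R * mu n)^-1 <= delta.
  by move=> delta_gt0; exact: (cvgr_le 0 cvg_row _ delta_gt0).
near=> n.
have n_ge2 : (2 <= n)%N by near: n; exact: nbhs_infty_ge.
have n_gt0 : (0 < n)%N by apply: leq_trans n_ge2.
have nR_gt0 : 0 < n%:R :> R by rewrite ltr0n.
have kn_gt0 : 0 < k%:R * n%:R :> R by rewrite mulr_gt0.
have mn_gt0 := m_gt0 n n_ge2.
have mu_gt0 : 0 < mu n by rewrite divr_gt0 ?exprn_gt0 ?ltr0n.
have mu_le1 : mu n <= 1.
  by near: n; exact: (cvgr_le 0 cvg_mu0 _ ltr01).
have up_le : n%:R * mu n ^+ k.+1 <= eps.
  by near: n; exact: (cvgr_le 0 cvg_up _ eps_gt0).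
have lo_le : (n%:R * mu n ^+ k)^-1 <= eps / 4 / B.
  by near: n; exact: (cvgr_le 0 cvg_lo _ (divr_gt0 eps4_gt0 B_gt0)).
have row_le : (n%:R * mu n)^-1 <= eps / 16.
  by near: n; apply: row_small; rewrite divr_gt0.
have row_le2 : (n%:R * mu n)^-1 <= (4 * k%:R)^-1.
  by near: n; apply: row_small; rewrite invr_gt0 mulr_gt0.
have n_le : n%:R^-1 <= eps / 4.
  rewrite -powR_inv1//; near: n; exact: (cvgr_le 0 cvg_n _ eps4_gt0).
set E := mean _.
pose s := (Num.truncn (eps / 4 * n%:R)).+1.
have s_itv : eps / 4 * n%:R <= s%:R <= eps / 4 * n%:R + 1.
  have /truncn_itv/andP[le lt] : 0 <= eps / 4 * n%:R by rewrite mulr_ge0 ?ltW.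
  by apply/andP; split; [exact: ltW|rewrite /s -natr1 lerD2r].
have mu_ge : 4 * k%:R <= n%:R * mu n.
  have k4_gt0 : 0 < 4 * k%:R :> R by rewrite mulr_gt0.
  by rewrite -lef_pV2 ?posrE// (mulr_gt0 nR_gt0 mu_gt0).
have lower :=
  mean_max_assignment_lb n_gt0 mn_gt0 k_gt0 eps4_gt0 s_itv mu_le1 mu_ge.
have upper := mean_max_assignment_le R (m n) k n_gt0.
rewrite -/E in lower upper; rewrite -/(mu n) in upper.
rewrite ler_distlC; apply/andP; split.
  rewrite ler_pdivlMr// mulrC; apply: le_trans lower; rewrite ler_pM2l//.
  rewrite lerD2l lerN2 -/B.
  have : B * (n%:R * mu n ^+ k)^-1 <= eps / 4.
    by rewrite mulrC -ler_pdivlMr.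
  by move: row_le n_le; rewrite -/(mu n); lra.
rewrite ler_pdivrMr//; apply: le_trans upper _.
have : n%:R * (n%:R * mu n ^+ k.+1) <= k%:R * n%:R * eps.
  rewrite mulrAC mulrC ler_pM2r//; apply: le_trans up_le _.
  by rewrite ler_peMl ?(ltW eps_gt0)// ler1n.
by rewrite mulrDl mul1r expr2 mulrA; lra.
Unshelve. all: by end_near. Qed.

Theorem theorem7 (R : realType) (c a : R) (m : nat -> nat)
    (d : nat -> measure_display) (T : forall n : nat, measurableType (d n))
    (P : forall n : nat, probability (T n) R)
    (X : forall n : nat, 'I_n -> 'I_n -> {RV (P n) >-> nat})
    (c_gt0 : 0 < c) (a_in01 : 0 < a < 1)
    (m_gt0 : forall n : nat, (2 <= n)%N -> (0 < m n)%N)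
    (X_law : forall n : nat, (2 <= n)%N ->
       multinomial_law (m n) (fun ij : 'I_n * 'I_n => X n ij.1 ij.2))
    (mp_asymp : exists2 e : nat -> R, e n @[n --> \oo] --> (0 : R) &
       \forall n \near \oo,
         (m n)%:R * n%:R ^- 2 = c * n%:R `^ (- a) * (1 + e n))
    (a_notin : forall k : nat, (0 < k)%N -> a <> 1 / k%:R) :
  exists k : nat,
    unique (fun j : nat => (0 < j)%N /\ 1 / (j%:R + 1) < a < 1 / j%:R) k /\
    exists2 e : nat -> R, e n @[n --> \oo] --> (0 : R) &
      \forall n \near \oo,
        ('E_(P n)[fun t : T n =>
           (\max_(s : 'S_n) \sum_(i < n) X n i (s i) t)%N%:R])%E
        = (k%:R * n%:R * (1 + e n))%:E.
Proof.
have [k k_unique] := unit_fraction_gap a_in01 a_notin.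
exists k; split=> //; have [[k_gt0 k_gap] _] := k_unique.
have [e e_cvg mu_e] := mp_asymp; case/andP: a_in01 => a_gt0 a_lt1.
pose E n : R := mean (fun f : {ffun 'I_(m n) -> 'I_n * 'I_n} =>
  (max_assignment (cell_count f))%:R).
exists (fun n => E n / (k%:R * n%:R) - 1).
  rewrite -(subrr (1 : R)); apply: cvgB; last exact: cvg_cst.
  exact: cvg_mean_max_assignment mu_e.
near=> n.
have n_ge2 : (2 <= n)%N by near: n; exact: nbhs_infty_ge.
have n_gt0 : (0 < n)%N by apply: leq_trans n_ge2.
have C_gt0 : (0 < #|{: 'I_n * 'I_n}|)%N.
  by rewrite card_prod !card_ord muln_gt0 n_gt0.
rewrite subrKC mulrC divfK ?gt_eqF ?mulr_gt0 ?ltr0n//.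
exact: (expectation_multinomial C_gt0 (X_law n n_ge2)
  (G := fun v => (max_assignment v)%:R)).
Unshelve. all: by end_near. Qed.
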